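(* Let $f:\mathbb{R}^d\to\mathbb{R}$ be differentiable with $f$ and $\nabla f$ both $L$-Lipschitz. For any $\varepsilon>0$ and $R>0$ there exist $N=\mathrm{poly}(1/\varepsilon,d,L,R)$ points $z_1,\dots,z_N\in\mathbb{R}^d$ such that $$\max_{n\le N}\|z_n\|\le 8\sqrt{(d+6)\log N},$$ $$\sup_{x\in\mathcal{B}^d(R)}\sup_{t\in[0,1]}\Big|\frac1N\sum_{n=1}^Nf(x+\sqrt tz_n)-Q_tf(x)\Big|\le\varepsilon,$$ $$\sup_{x\in\mathcal{B}^d(R)}\sup_{t\in[0,1]}\Big\|\frac1N\sum_{n=1}^N\nabla f(x+\sqrt tz_n)-\nabla Q_tf(x)\Big\|\le\varepsilon.$$
   Context: $Q_tf(x)=\mathbf{E}[f(x+\sqrt tZ)]$ with $Z\sim\gamma_d$ (standard Gaussian on $\mathbb{R}^d$) is the heat semigroup; $\mathcal{B}^d(R)$ is the Euclidean ball of radius $R$ centered at $0$. *)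

(* Defs.v *)
From HB Require Import structures.
From mathcomp Require Import all_boot all_order all_algebra.
From mathcomp Require Import all_classical all_reals all_analysis.
Set Implicit Arguments. Unset Strict Implicit. Unset Printing Implicit Defensive.
Import Order.TTheory GRing.Theory Num.Theory.
Import numFieldNormedType.Exports.
Local Open Scope ring_scope.
Local Open Scope classical_set_scope.

(* R^d is 'rV[R]_d. Euclidean norm (the library norm on 'rV is the max norm). *)
Definition enorm {R : realType} {d : nat} (v : 'rV[R]_d) : R :=
  Num.sqrt (\sum_(i < d) v ord0 i ^+ 2).

Definition vcons {R : realType} {d : nat} (s : R) (z : 'rV[R]_d) : 'rV[R]_d.+1 :=
  \row_(i < d.+1) (if unlift ord0 i is Some j then z ord0 j else s).

(* E[g(Z)], Z ~ gamma_d (standard Gaussian on R^d), computed as the iterated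
   integral against d independent standard normal coordinates N(0,1). *)
Fixpoint gauss_expect {R : realType} (d : nat) : ('rV[R]_d -> R) -> R :=
  match d return ('rV[R]_d -> R) -> R with
  | 0 => fun g => g 0
  | d'.+1 => fun g =>
      Rintegral (normal_prob (0:R) 1) setT
        (fun s : R => gauss_expect (fun z : 'rV[R]_d' => g (vcons s z)))
  end.

Definition heatQ {R : realType} {d : nat} (t : R) (f : 'rV[R]_d -> R)
  (x : 'rV[R]_d) : R :=
  gauss_expect (fun z => f (x + Num.sqrt t *: z)).

Definition grad {R : realType} {d : nat} (f : 'rV[R]_d -> R) (x : 'rV[R]_d)
  : 'rV[R]_d :=
  \row_(i < d) ('d f x : 'rV[R]_d -> R) (delta_mx ord0 i).

(* Main.v *)
(* Restrict the Gaussian to a box by clipping each coordinate to [-M, M] with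
   M = 8 sqrt(log N); for Lipschitz functions this changes Gaussian means by at
   most O(d L exp(-M^2/2)), and every sample then has norm at most M sqrt d.
   Both sides of the two estimates are Lipschitz in (x, sqrt t), so it suffices
   to control f and the d partial derivatives on a finite grid of exponential
   size in d.  The points are picked one at a time: for centred observables Y_p,
   the potential sum_p prod_k (1 + lambda Y_p(z_k)) is a martingale when the z_k
   are Gaussian, so the next point can always be chosen without exceeding the
   initial bound, and 1 + y >= exp(y - 2 y^2) turns the final bound on the
   potential into a Hoeffding estimate for every grid point at once.
   Finally grad (Q_t f) = Q_t (grad f) because f has a first-order expansion
   with a quadratic remainder uniform in the base point. *)
Require Import Defs.
From HB Require Import structures.
From mathcomp Require Import all_boot all_order all_algebra.
From mathcomp Require Import all_classical all_reals all_analysis.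
From mathcomp Require Import measurable_realfun ring lra.
Set Implicit Arguments. Unset Strict Implicit. Unset Printing Implicit Defensive.
Import Order.TTheory GRing.Theory Num.Theory.
Import numFieldNormedType.Exports.
Local Open Scope ring_scope.

(** * One-dimensional Gaussian integrals and the cost of clipping *)

Section Gaussian1.
Context {R : realType}.
Local Notation mu := (@lebesgue_measure R).
Local Notation gauss := (normal_prob (0 : R) 1).
Implicit Types (h : R -> R) (a K M : R).

(** The Radon-Nikodym derivative of the normal law agrees almost everywhere with [normal_pdf], since
    both have the same integral over every measurable set. *)
Lemma integral_normal_prob (m s : R) h :
    measurable_fun setT h -> (forall x, 0 <= h x) ->
  (\int[normal_prob m s]_x (h x)%:E = \int[mu]_x (h x * normal_pdf m s x)%:E)%E.
Proof.
move=> mh h0; have dom := normal_prob_dominates m s.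
rewrite -(Radon_Nikodym_SigmaFinite.change_of_variables dom) //; last first.
  exact/measurable_EFinP.
have mpdf := @measurable_normal_pdf R m s.
have if_ := Radon_Nikodym_SigmaFinite.f_integrable dom.
under [RHS]eq_integral do rewrite EFinM.
apply: ae_eq_integral => //.
- apply: emeasurable_funM; first exact/measurable_EFinP.
  exact: (measurable_int _ if_).
- by apply: emeasurable_funM; exact/measurable_EFinP.
- apply: ae_eqe_mul2l; apply: integral_ae_eq => //.
  + exact/measurable_EFinP.
  + move=> E _ mE.
    by rewrite -(Radon_Nikodym_SigmaFinite.f_integral dom).
Qed.

(** Completing the square turns exp(a x) times the standard density into exp(a^2/2) times the
    density of N(a,1). *)
Lemma normal_mgf a :
  (\int[gauss]_x (expR (a * x))%:E = (expR (a ^+ 2 / 2))%:E)%E.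
Proof.
rewrite integral_normal_prob; last by move=> x; exact: expR_ge0.
  under eq_integral => x _.
    rewrite (_ : _ * _ = expR (a ^+ 2 / 2) * normal_pdf a 1 x); last first.
      rewrite !normal_pdfE ?oner_neq0 // /normal_fun mulrCA [RHS]mulrCA.
      by congr (_ * _); rewrite -!expRD; congr expR; field.
    rewrite EFinM; over.
  rewrite integralZl // ?integral_normal_pdf ?mule1 //.
  exact: integrable_normal_pdf.
by apply: measurableT_comp => //; exact: measurable_funM.
Qed.

Local Notation gauss_integrable h := (gauss.-integrable setT (EFin \o h)).

Lemma gauss_integrableD h1 h2 : gauss_integrable h1 -> gauss_integrable h2 ->
  gauss_integrable (fun x => h1 x + h2 x).
Proof. by move=> i1 i2; exact: (integrableD measurableT i1 i2). Qed.

Lemma gauss_integrableZ a h : gauss_integrable h ->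
  gauss_integrable (fun x => a * h x).
Proof. by move=> i1; exact: (integrableZl measurableT a i1). Qed.

Lemma gauss_integrable_cst a : gauss_integrable (fun=> a).
Proof. exact: (finite_measure_integrable_cst gauss a measurableT). Qed.

Lemma gauss_Rintegral_cst a : \int[gauss]_x a = a.
Proof.
rewrite Rintegral_cst // -[RHS]mulr1; congr (_ * _).
by rewrite -[RHS]/(fine 1%E) -(@probability_setT _ _ _ gauss).
Qed.

Lemma integrable_normal_exp a : gauss_integrable (fun x => expR (a * x)).
Proof.
apply/integrableP; split.
  by apply/measurable_EFinP/measurableT_comp => //; exact: measurable_funM.
under eq_integral do rewrite gee0_abs ?lee_fin ?expR_ge0 //.
by rewrite normal_mgf ltry.
Qed.

Lemma lipschitz_continuous (V : normedModType R) K (h : V -> R) :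
  (forall x y, `|h x - h y| <= K * `|x - y|) -> continuous h.
Proof.
move=> hK x; apply/cvgrPdist_le => e e0.
have K1 : 0 < `|K| + 1 by rewrite ltr_wpDl.
near=> y.
rewrite (le_trans (hK x y)) // (le_trans (ler_wpM2r (normr_ge0 _) (ler_norm K))) //.
rewrite (@le_trans _ _ ((`|K| + 1) * `|x - y|)) //; first by rewrite ler_wpM2r // lerDl.
rewrite -ler_pdivlMl //.
near: y; apply: cvgr_dist_le; last by rewrite mulr_gt0 // invr_gt0.
exact: cvg_id.
Unshelve. all: by end_near. Qed.

Lemma normr_le_expR (x : R) : `|x| <= expR (1 * x) + expR (- 1 * x).
Proof.
rewrite mul1r mulN1r; have := expR_ge1Dx x; have := expR_ge1Dx (- x).
have := expR_ge0 x; have := expR_ge0 (- x).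
by case: (ler0P x) => ?; lra.
Qed.

(** Lipschitz growth is at most linear, hence dominated by exponentials with finite Gaussian
    integral. *)
Lemma integrable_normal_lipschitz K h :
    (forall x y, `|h x - h y| <= K * `|x - y|) ->
  gauss_integrable h.
Proof.
move=> hK; have mh : measurable_fun setT h.
  by apply: continuous_measurable_fun; exact: lipschitz_continuous hK.
pose g x := `|h 0| + `|K| * (expR (1 * x) + expR (- 1 * x)).
have ig : gauss.-integrable setT (EFin \o g).
  apply: gauss_integrableD; first exact: gauss_integrable_cst.
  by apply: gauss_integrableZ; apply: gauss_integrableD; exact: integrable_normal_exp.
apply: (le_integrable measurableT _ _ ig); first exact/measurable_EFinP.
move=> x _ /=; rewrite lee_fin [leRHS]ger0_norm; last first.
  by rewrite addr_ge0 // mulr_ge0 // addr_ge0 // expR_ge0.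
have -> : h x = h 0 + (h x - h 0) by rewrite addrC subrK.
rewrite (le_trans (ler_normD _ _)) // lerD2l (le_trans (hK _ _)) //.
rewrite (le_trans (ler_wpM2r (normr_ge0 _) (ler_norm K))) //.
by rewrite subr0 ler_wpM2l // normr_le_expR.
Qed.

Definition clip M (x : R) : R := if x < - M then - M else if M < x then M else x.

Lemma clip_lipschitz M x y : 0 <= M -> `|clip M x - clip M y| <= `|x - y|.
Proof.
move=> M0; rewrite /clip.
have := ler_norm (x - y); have := ler_norm (y - x); rewrite (distrC y x).
rewrite ler_norml; case: (ltP x (- M)) => ?; last case: (ltP M x) => ?;
  case: (ltP y (- M)) => ?; try case: (ltP M y) => ?; move=> *; apply/andP; split; lra.
Qed.

Lemma clip_le M x : 0 <= M -> `|clip M x| <= M.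
Proof.
by move=> M0; rewrite /clip ler_norml; case: (ltP x (- M)) => ?; last case: (ltP M x) => ?;
  apply/andP; split; lra.
Qed.

(* [M * (|x| - M) <= exp (M * (|x| - M))], and the Gaussian integral of
   [exp (± M x)] is [exp (M^2 / 2)]. *)
Lemma normal_clip_le M : 1 <= M ->
  \int[gauss]_x `|x - clip M x| <= 2 * expR (- (M ^+ 2 / 2)).
Proof.
move=> M1; pose g x := expR (- M ^+ 2) * (expR (M * x) + expR (- M * x)).
have ie : gauss_integrable (fun x => expR (M * x) + expR (- M * x)).
  by apply: gauss_integrableD; exact: integrable_normal_exp.
have -> : 2 * expR (- (M ^+ 2 / 2)) = \int[gauss]_x g x.
  rewrite RintegralZl // RintegralD //; try exact: integrable_normal_exp.
  rewrite /Rintegral !normal_mgf /= sqrrN.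
  rewrite (_ : - (M ^+ 2 / 2) = - M ^+ 2 + M ^+ 2 / 2) ?expRD; first by ring.
  by field.
apply: le_Rintegral => //; [|exact: gauss_integrableZ|].
  apply: (@integrable_normal_lipschitz 2) => x y.
  have := clip_lipschitz x y (le_trans ler01 M1).
  have -> : x - clip M x = (y - clip M y) + ((x - y) - (clip M x - clip M y)) by ring.
  have := ler_dist_dist (y - clip M y + (x - y - (clip M x - clip M y))) (y - clip M y).
  rewrite [y - _ + _ - _]addrC addKr.
  have := ler_normB (x - y) (clip M x - clip M y).
  lra.
move=> x _; rewrite /g mulrDr -!expRD.
have := expR_ge0 (- M ^+ 2 + M * x); have := expR_ge0 (- M ^+ 2 + - M * x).
have := expR_ge1Dx (- M ^+ 2 + M * x); have := expR_ge1Dx (- M ^+ 2 + - M * x).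
set e1 := expR _; set e2 := expR _.
rewrite /clip; case: (ltP x (- M)) => ?; last case: (ltP M x) => ?;
  rewrite ler_norml => *; apply/andP; split; nra.
Qed.

End Gaussian1.

(** * Comparison of the Euclidean norm with coordinates *)

Section EuclideanNorm.
Context {R : realType} {d : nat}.
Implicit Types (v w : 'rV[R]_d) (a : R).

Lemma rowBE (u v : 'rV[R]_d) i : (u - v) ord0 i = u ord0 i - v ord0 i.
Proof. by rewrite !mxE. Qed.

Lemma enorm_ge0 v : 0 <= enorm v.
Proof. exact: sqrtr_ge0. Qed.

Lemma rowZE a v i : (a *: v) ord0 i = a * v ord0 i.
Proof. by rewrite mxE. Qed.

Lemma enormZ a v : enorm (a *: v) = `|a| * enorm v.
Proof.
rewrite /enorm -sqrtr_sqr -sqrtrM ?sqr_ge0 // mulr_sumr.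
by congr Num.sqrt; apply: eq_bigr => i _; rewrite mxE exprMn.
Qed.

Lemma normr_le_enorm v i : `|v ord0 i| <= enorm v.
Proof.
rewrite -sqrtr_sqr ler_wsqrtr // (bigD1 i) //= lerDl.
by apply: sumr_ge0 => j _; exact: sqr_ge0.
Qed.

Lemma enorm_le_sum v : enorm v <= \sum_(i < d) `|v ord0 i|.
Proof.
have s0 : 0 <= \sum_(i < d) `|v ord0 i| by apply: sumr_ge0.
rewrite -[leRHS]ger0_norm // -sqrtr_sqr ler_wsqrtr // expr2 mulr_suml.
apply: ler_sum => i _; rewrite -(real_normK (num_real _)) expr2 ler_wpM2l //.
by rewrite (bigD1 i) //= lerDl; apply: sumr_ge0.
Qed.

Lemma ler_enorm v w : (forall i, `|v ord0 i| <= `|w ord0 i|) -> enorm v <= enorm w.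
Proof.
move=> vw; rewrite ler_wsqrtr //; apply: ler_sum => i _.
by rewrite -(real_normK (num_real (v _ _))) -(real_normK (num_real (w _ _))) lerXn2r ?nnegrE.
Qed.

End EuclideanNorm.

(** * Euclidean distances after splitting off the first coordinate *)

Section Vcons.
Context {R : realType} {d : nat}.
Implicit Types (z w : 'rV[R]_d) (s t : R).

Lemma enorm_vcons_distl s t z : enorm (vcons s z - vcons t z) = `|s - t|.
Proof.
rewrite /enorm big_ord_recl big1 ?addr0 => [|i _].
  by rewrite !mxE unlift_none sqrtr_sqr.
by rewrite !mxE liftK subrr expr0n.
Qed.

Lemma enorm_vcons_distr s z w : enorm (vcons s z - vcons s w) = enorm (z - w).
Proof.
rewrite /enorm big_ord_recl !mxE unlift_none subrr expr0n add0r.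
by congr Num.sqrt; apply: eq_bigr => i _; rewrite !mxE liftK.
Qed.

End Vcons.

(** * Functions Lipschitz for the Euclidean norm *)

Definition elip {R : realType} {d : nat} (K : R) (g : 'rV[R]_d -> R) :=
  forall x y, `|g x - g y| <= K * enorm (x - y).

Section Lipschitz.
Context {R : realType} {d : nat}.
Implicit Types (g : 'rV[R]_d -> R) (K a : R).

Lemma elip_cst a : elip 0 (fun _ : 'rV[R]_d => a).
Proof. by move=> x y; rewrite subrr normr0 mul0r. Qed.

Lemma elipD K1 K2 g1 g2 : elip K1 g1 -> elip K2 g2 ->
  elip (K1 + K2) (fun x => g1 x + g2 x).
Proof.
move=> l1 l2 x y; rewrite mulrDl opprD addrACA.
by rewrite (le_trans (ler_normD _ _)) // lerD.
Qed.

Lemma elipZ a K g : elip K g -> elip (`|a| * K) (fun x => a * g x).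
Proof. by move=> l x y; rewrite -mulrBr normrM -mulrA ler_wpM2l. Qed.

Lemma elipB K1 K2 g1 g2 : elip K1 g1 -> elip K2 g2 ->
  elip (K1 + K2) (fun x => g1 x - g2 x).
Proof.
move=> l1 l2 x y; rewrite mulrDl (_ : _ - _ - _ = (g1 x - g1 y) - (g2 x - g2 y)).
  by rewrite (le_trans (ler_normB _ _)) // lerD.
by ring.
Qed.

Lemma elip_sum (I : finType) (K : I -> R) (g : I -> 'rV[R]_d -> R) :
  (forall i, elip (K i) (g i)) -> elip (\sum_i K i) (fun x => \sum_i g i x).
Proof.
move=> l x y; rewrite -sumrB mulr_suml (le_trans (ler_norm_sum _ _ _)) //.
by apply: ler_sum => i _; exact: l.
Qed.

Lemma elip_le (K K' : R) (g : 'rV[R]_d -> R) : K <= K' -> elip K g -> elip K' g.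
Proof. by move=> KK l x y; rewrite (le_trans (l x y)) // ler_wpM2r ?enorm_ge0. Qed.

Lemma elip_affine K g x a : elip K g -> elip (K * `|a|) (fun z => g (x + a *: z)).
Proof.
move=> l y z; rewrite (le_trans (l _ _)) // -mulrA -enormZ scalerBr.
by rewrite opprD addrACA subrr add0r.
Qed.

End Lipschitz.

(** * Monotonicity and linearity of Gaussian expectation on Lipschitz functions *)

Section Expectation.
Context {R : realType}.
Local Notation E := gauss_expect.

Lemma elip_vcons d K (g : 'rV[R]_d.+1 -> R) s : elip K g -> elip K (fun z => g (vcons s z)).
Proof. by move=> l x y; rewrite -(enorm_vcons_distr s) l. Qed.

Lemma gauss_expect_cst d (a : R) : E (fun _ : 'rV[R]_d => a) = a.
Proof.
elim: d => [//|d IH] /=; under eq_Rintegral do rewrite IH.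
exact: gauss_Rintegral_cst.
Qed.

(** Both properties are carried through one induction on [d]: together they make slice means
    Lipschitz in the first coordinate, hence integrable, which the outer integral in the next
    dimension requires. *)
Let spec d :=
  (forall K1 K2 (g1 g2 : 'rV[R]_d -> R), elip K1 g1 -> elip K2 g2 ->
    (forall x, g1 x <= g2 x) -> E g1 <= E g2) /\
  (forall K1 K2 (g1 g2 : 'rV[R]_d -> R) a, elip K1 g1 -> elip K2 g2 ->
    E (fun x => a * g1 x + g2 x) = a * E g1 + E g2).

(** Monotonicity applied to [g1 <= g2 + c] and [g2 <= g1 + c]. Taking [spec d] as a premise makes it
    available inside the induction. *)
Let spec_dist d K1 K2 (g1 g2 : 'rV[R]_d -> R) c : spec d ->
  elip K1 g1 -> elip K2 g2 ->
  (forall x, `|g1 x - g2 x| <= c) -> `|E g1 - E g2| <= c.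
Proof.
move=> [mono lin] l1 l2 g12.
have shift K (g : 'rV[R]_d -> R) : elip K g -> E (fun x => 1 * g x + c) = E g + c.
  by move=> l; rewrite (lin K 0) ?mul1r ?gauss_expect_cst //; exact: elip_cst.
have lc K (g : 'rV[R]_d -> R) : elip K g -> elip (`|1| * K + 0) (fun x => 1 * g x + c).
  by move=> l; apply: elipD; [exact: elipZ|exact: elip_cst].
have h1 : E g1 <= E g2 + c.
  rewrite -(shift _ _ l2); apply: (mono _ _ _ _ l1 (lc _ _ l2)) => x.
  by have := g12 x; rewrite mul1r ler_norml; lra.
have h2 : E g2 <= E g1 + c.
  rewrite -(shift _ _ l1); apply: (mono _ _ _ _ l2 (lc _ _ l1)) => x.
  by have := g12 x; rewrite mul1r ler_norml; lra.
by rewrite ler_norml; apply/andP; split; lra.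
Qed.

Let spec_lip d K (g : 'rV[R]_d.+1 -> R) : spec d -> elip K g -> forall s t,
  `|E (fun z => g (vcons s z)) - E (fun z => g (vcons t z))| <= K * `|s - t|.
Proof.
move=> sp l s t; apply: (spec_dist sp (elip_vcons s l) (elip_vcons t l)) => z.
by rewrite -(enorm_vcons_distl s t z) l.
Qed.

Let gauss_expect_spec d : spec d.
Proof.
elim: d => [|d IH]; first by split=> /=.
have int K (g : 'rV[R]_d.+1 -> R) (l : elip K g) :=
  integrable_normal_lipschitz (spec_lip IH l).
split=> [K1 K2 g1 g2 l1 l2 g12 /=|K1 K2 g1 g2 a l1 l2 /=].
  apply: le_Rintegral => //; [exact: int l1|exact: int l2|] => s _.
  by case: IH => + _; apply; [exact: elip_vcons l1|exact: elip_vcons l2|].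
under eq_Rintegral => s _ do rewrite (IH.2 _ _ _ _ a (elip_vcons s l1) (elip_vcons s l2)).
rewrite RintegralD ?RintegralZl //; try exact: int l1; try exact: int l2.
by apply: gauss_integrableZ; exact: int l1.
Qed.

Lemma gauss_expect_le d K1 K2 (g1 g2 : 'rV[R]_d -> R) : elip K1 g1 -> elip K2 g2 ->
  (forall x, g1 x <= g2 x) -> E g1 <= E g2.
Proof. exact: (gauss_expect_spec d).1. Qed.

Lemma gauss_expect_lin d K1 K2 (g1 g2 : 'rV[R]_d -> R) a : elip K1 g1 -> elip K2 g2 ->
  E (fun x => a * g1 x + g2 x) = a * E g1 + E g2.
Proof. exact: (gauss_expect_spec d).2. Qed.

Lemma gauss_expect_dist d K1 K2 (g1 g2 : 'rV[R]_d -> R) c : elip K1 g1 -> elip K2 g2 ->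
  (forall x, `|g1 x - g2 x| <= c) -> `|E g1 - E g2| <= c.
Proof. exact: spec_dist. Qed.

Lemma integrable_gauss_expect d K (g : 'rV[R]_d.+1 -> R) : elip K g ->
  (normal_prob (0 : R) 1).-integrable setT (EFin \o (fun s => E (fun z => g (vcons s z)))).
Proof. by move=> l; apply: (@integrable_normal_lipschitz _ K); exact: spec_lip. Qed.

Lemma eq_gauss_expect d (g1 g2 : 'rV[R]_d -> R) : g1 =1 g2 -> E g1 = E g2.
Proof. by move=> /funext ->. Qed.

Lemma gauss_expectZ d K (g : 'rV[R]_d -> R) a : elip K g ->
  E (fun x => a * g x) = a * E g.
Proof.
move=> l; rewrite -[RHS]addr0 -[X in _ + X](gauss_expect_cst d 0).
rewrite -(gauss_expect_lin _ l (elip_cst 0)).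
by apply: eq_gauss_expect => x; rewrite addr0.
Qed.

Lemma gauss_expectD d K1 K2 (g1 g2 : 'rV[R]_d -> R) : elip K1 g1 -> elip K2 g2 ->
  E (fun x => g1 x + g2 x) = E g1 + E g2.
Proof.
move=> l1 l2; rewrite -[E g1]mul1r -(gauss_expect_lin 1 l1 l2).
by apply: eq_gauss_expect => x; rewrite mul1r.
Qed.

Lemma gauss_expectB d K1 K2 (g1 g2 : 'rV[R]_d -> R) : elip K1 g1 -> elip K2 g2 ->
  E (fun x => g1 x - g2 x) = E g1 - E g2.
Proof.
move=> l1 l2; rewrite addrC -mulN1r -(gauss_expect_lin (-1) l2 l1).
by apply: eq_gauss_expect => x; rewrite mulN1r addrC.
Qed.

Lemma gauss_expect_sum d (I : finType) (K : I -> R) (g : I -> 'rV[R]_d -> R) :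
  (forall i, elip (K i) (g i)) ->
  E (fun x => \sum_i g i x) = \sum_i E (g i).
Proof.
move=> l; have ls (s : seq I) : elip (\sum_(i <- s) K i) (fun x => \sum_(i <- s) g i x).
  move=> x y; rewrite -sumrB mulr_suml (le_trans (ler_norm_sum _ _ _)) //.
  by apply: ler_sum => i _; exact: l.
elim: (index_enum I) => [|i s IH].
  by rewrite big_nil -[RHS](gauss_expect_cst d 0); apply: eq_gauss_expect => x; rewrite big_nil.
rewrite big_cons -IH -(gauss_expectD (l i) (ls s)).
by apply: eq_gauss_expect => x; rewrite big_cons.
Qed.

End Expectation.

(** * Clipping all coordinates and its effect on Gaussian means *)

Section Truncation.
Context {R : realType}.
Local Notation E := gauss_expect.

Definition clipv d (M : R) (z : 'rV[R]_d) : 'rV[R]_d := \row_i clip M (z ord0 i).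

Lemma clipv_vcons d M s (z : 'rV[R]_d) :
  clipv M (vcons s z) = vcons (clip M s) (clipv M z).
Proof. by apply/rowP => i; rewrite !mxE; case: unlift => [j|//]; rewrite !mxE. Qed.

Lemma elip_clipv d (K M : R) (g : 'rV[R]_d -> R) : 0 <= K -> 0 <= M -> elip K g ->
  elip K (fun z => g (clipv M z)).
Proof.
move=> K0 M0 l x y; rewrite (le_trans (l _ _)) // ler_wpM2l // ler_enorm // => i.
by rewrite !mxE clip_lipschitz.
Qed.

Lemma enorm_clipv d M (z : 'rV[R]_d) : 0 <= M -> enorm (clipv M z) <= M * Num.sqrt d%:R.
Proof.
move=> M0; rewrite -{2}(ger0_norm M0) -sqrtr_sqr -sqrtrM ?sqr_ge0 // ler_wsqrtr //.
rewrite (@le_trans _ _ (\sum_(i < d) M ^+ 2)) //.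
  apply: ler_sum => i _; rewrite mxE -(real_normK (num_real _)).
  by rewrite lerXn2r ?nnegrE // clip_le.
by rewrite sumr_const card_ord mulr_natr.
Qed.

(** A cruder, root-free bound, used for the discretization error; the sharp one controls the norms
    of the sample points. *)
Lemma enorm_clipv_le d M (z : 'rV[R]_d) : 0 <= M -> enorm (clipv M z) <= d%:R * M.
Proof.
move=> M0; rewrite (le_trans (enorm_le_sum _)) //.
have <- : \sum_(i < d) M = d%:R * M by rewrite sumr_const card_ord -(mulr_natl M).
by apply: ler_sum => i _; rewrite mxE clip_le.
Qed.

Lemma enorm_clipvB d M (z w : 'rV[R]_d) : 0 <= M ->
  enorm (clipv M z - clipv M w) <= d%:R * (2 * M).
Proof.
move=> M0; rewrite (le_trans (enorm_le_sum _)) //.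
have <- : \sum_(i < d) (2 * M) = d%:R * (2 * M) by rewrite sumr_const card_ord -[LHS]mulr_natl.
apply: ler_sum => i _; rewrite !mxE (le_trans (ler_normB _ _)) //.
by have := clip_le (z ord0 i) M0; have := clip_le (w ord0 i) M0; lra.
Qed.

(** Coordinates are clipped one at a time: clipping the first costs [K * |s - clip M s|], whose mean
    is bounded by [normal_clip_le], and the induction hypothesis handles the others. *)
Lemma gauss_expect_clipv d (K M : R) (g : 'rV[R]_d -> R) : 0 <= K -> 1 <= M -> elip K g ->
  `|E g - E (fun z => g (clipv M z))| <= d%:R * (K * (2 * expR (- (M ^+ 2 / 2)))).
Proof.
move=> K0 M1; have M0 := le_trans ler01 M1.
set del := 2 * _.
elim: d g => [|d IH] g l.
  by rewrite mul0r /= (_ : clipv M 0 = 0) ?subrr ?normr0 //; apply/rowP => -[].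
rewrite /=.
have lc := elip_clipv K0 M0 l.
have i1 := integrable_gauss_expect l; have i2 := integrable_gauss_expect lc.
have ic : (normal_prob (0 : R) 1).-integrable setT (EFin \o (fun s => `|s - clip M s|)).
  apply: (@integrable_normal_lipschitz _ 2) => x y.
  have := clip_lipschitz x y M0.
  have := ler_dist_dist (x - clip M x) (y - clip M y).
  have := ler_normB (x - y) (clip M x - clip M y).
  rewrite (_ : x - clip M x - (y - clip M y) = x - y - (clip M x - clip M y)); first lra.
  by ring.
rewrite -RintegralB //.
apply: (le_trans (le_normr_Rintegral _ _)) => //.
  exact: (integrableB measurableT i1 i2).
pose u (s : R) := K * `|s - clip M s| + d%:R * (K * del).
have iu : (normal_prob (0 : R) 1).-integrable setT (EFin \o u).
  by apply: gauss_integrableD; [exact: gauss_integrableZ|exact: gauss_integrable_cst].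
apply: (@le_trans _ _ (\int[normal_prob (0 : R) 1]_s u s)).
  apply: le_Rintegral => //.
    have := integrable_norm (integrableB measurableT i1 i2); exact.
  move=> s _.
  have h1 : `|E (fun z => g (vcons s z)) - E (fun z => g (vcons (clip M s) z))|
      <= K * `|s - clip M s|.
    apply: (gauss_expect_dist (elip_vcons s l) (elip_vcons _ l)) => z.
    by rewrite -(enorm_vcons_distl s (clip M s) z) l.
  have h2 := IH _ (elip_vcons (clip M s) l).
  rewrite (eq_gauss_expect (g1 := fun z => g (clipv M (vcons s z)))
    (g2 := fun z => g (vcons (clip M s) (clipv M z)))); last first.
    by move=> z; rewrite clipv_vcons.
  rewrite (le_trans (ler_distD (E (fun z => g (vcons (clip M s) z))) _ _)) //.
  exact: lerD.
rewrite RintegralD //; last 2 first.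
- exact: gauss_integrableZ.
- exact: gauss_integrable_cst.
rewrite RintegralZl // gauss_Rintegral_cst.
rewrite -natr1 mulrDl mul1r addrC lerD2l ler_wpM2l //.
exact: normal_clip_le.
Qed.

End Truncation.

(** * Choice of points by a potential argument *)

Section Sampling.
Context {R : realType} {d : nat}.
Local Notation E := gauss_expect.

(** With w = y - 2 y^2, exp(-w) >= 1 - w gives exp(w) <= 1/(1 - w), and (1 + y)(1 - w) = 1 + y^2 (1
    + 2y) >= 1 on this range. *)
Lemma expR_le_1D (y : R) : `|y| <= 2^-1 -> expR (y - 2 * y ^+ 2) <= 1 + y.
Proof.
rewrite ler_norml => /andP[y1 y2].
have h := expR_ge1Dx (- (y - 2 * y ^+ 2)).
have p := expR_gt0 (y - 2 * y ^+ 2).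
rewrite expRN in h.
set e := expR _ in h p *.
have : (1 - y + 2 * y ^+ 2) * e <= 1.
  by rewrite -ler_pdivlMr // mul1r; lra.
have -> : e = e * 1 by rewrite mulr1.
by nra.
Qed.

Lemma exists_le_gauss_expect K (h : 'rV[R]_d -> R) c : elip K h -> E h < c ->
  exists z, h z < c.
Proof.
move=> l hc; apply: contrapT => /forallNP hn.
suff : c <= E h by rewrite leNgt hc.
rewrite -(gauss_expect_cst d c); apply: (gauss_expect_le (elip_cst c) l) => z.
by rewrite leNgt; apply/negP; exact: hn.
Qed.

(* Given z_0, ..., z_(n-1), the next point is chosen so that the potential does
   not exceed its bound; this is possible because, the Y i being centred, the
   Gaussian mean of the next potential is the current one. *)
Lemma exists_potential_lt (I : finType) (K : R) (Y : I -> 'rV[R]_d -> R) (n : nat) :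
    (forall i, elip K (Y i)) -> (forall i, E (Y i) = 0) ->
  exists z : nat -> 'rV[R]_d,
    \sum_i \prod_(k < n) (1 + Y i (z k)) < #|I|%:R + 1.
Proof.
move=> l e0; elim: n => [|n [z zlt]].
  (* The empty products sum to [#|I|]; the extra 1 gives the strict inequality needed to choose a
     point. *)
  exists (fun=> 0); under eq_bigr do rewrite big_ord0.
  by rewrite sumr_const cardT -cardE ltrDl.
pose c i := \prod_(k < n) (1 + Y i (z k)).
have l1 i : elip (`|c i| * (0 + K)) (fun w => c i * (1 + Y i w)).
  by apply: elipZ; apply: elipD (l i); exact: elip_cst.
have [w wlt] : exists w, \sum_i c i * (1 + Y i w) < #|I|%:R + 1.
  apply: (exists_le_gauss_expect (elip_sum l1)).
  rewrite (gauss_expect_sum l1); apply: le_lt_trans zlt.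
  apply: ler_sum => i _; rewrite (gauss_expectZ _ (elipD (elip_cst 1) (l i))).
  by rewrite (gauss_expectD (elip_cst 1) (l i)) gauss_expect_cst e0 addr0 mulr1.
exists (fun k => if k == n then w else z k).
under eq_bigr => i _.
  rewrite big_ord_recr /= eqxx.
  under eq_bigr => k _ do rewrite (ltn_eqF (ltn_ord k)).
  over.
exact: wlt.
Qed.

Lemma sample_points (I : finType) (K B eps : R) (N : nat) (g : I -> 'rV[R]_d -> R) :
    (forall i, elip K (g i)) -> (forall i z w, `|g i z - g i w| <= B) ->
    (0 < N)%N -> 0 < eps -> eps <= 2 * B ->
    2 * #|I|%:R + 1 <= expR (N%:R * (eps ^+ 2 / (8 * B ^+ 2))) ->
  exists z : nat -> 'rV[R]_d,
    forall i, `|N%:R^-1 * (\sum_(k < N) g i (z k)) - E (g i)| <= eps.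
Proof.
move=> l osc N0 eps0 epsB hN.
have B0 : 0 < B by lra.
(* This value maximizes lam eps - 2 lam^2 B^2, with maximum eps^2 / (8 B^2), the rate in [hN]. *)
pose lam := eps / (4 * B ^+ 2).
have lam0 : 0 < lam by rewrite divr_gt0 // mulr_gt0 // exprn_gt0.
(* Both signs of each observable enter the potential, so that one-sided bounds give the absolute
   value; this doubles the index set. *)
pose s (b : bool) : R := if b then lam else - lam.
pose Y (p : I * bool) z := s p.2 * (g p.1 z - E (g p.1)).
have sabs b : `|s b| = lam by rewrite /s; case: b; rewrite ?normrN gtr0_norm.
have lg i := elipB (l i) (elip_cst (E (g i))).
have lY p : elip (lam * (K + 0)) (Y p) by rewrite -(sabs p.2); exact: elipZ.
have eY p : E (Y p) = 0.
  rewrite (gauss_expectZ _ (lg _)) (gauss_expectB (l _) (elip_cst _)).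
  by rewrite gauss_expect_cst subrr mulr0.
have bg i z : `|g i z - E (g i)| <= B.
  by rewrite -(gauss_expect_cst d (g i z)); apply: (gauss_expect_dist (elip_cst _) (l i)).
have bY p z : `|Y p z| <= lam * B by rewrite normrM sabs ler_wpM2l // ltW.
(* The assumption [eps <= 2 * B] is exactly what brings [Y] into the range of [expR_le_1D]. *)
have lamB : lam * B <= 2^-1.
  have -> : lam * B = eps / (4 * B) by rewrite /lam; field; rewrite gt_eqF.
  by rewrite ler_pdivrMr ?mulr_gt0 //; lra.
have [z zlt] := exists_potential_lt N lY eY.
exists z.
(* All products are nonnegative, so a single sum above the threshold would already push the
   potential up to [2 * #|I| + 1], contradicting [zlt]. *)
have key p : \sum_(k < N) Y p (z k) <= lam * (N%:R * eps).
  rewrite leNgt; apply/negP => Sgt; move: zlt; apply/negP; rewrite -leNgt.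
  have pos q : 0 <= \prod_(k < N) (1 + Y q (z k)).
    apply: prodr_ge0 => k _; have := le_trans (bY q (z k)) lamB.
    by rewrite ler_norml; lra.
  rewrite (bigD1 p) //= (@le_trans _ _ (\prod_(k < N) (1 + Y p (z k)))) //; last first.
    by rewrite lerDl; apply: sumr_ge0.
  apply: (@le_trans _ _ (\prod_(k < N) expR (Y p (z k) - 2 * (lam * B) ^+ 2))).
    rewrite -expR_sum sumrB sumr_const card_ord -(mulr_natl (2 * _)).
    rewrite card_prod card_bool natrM (mulrC #|I|%:R) (le_trans hN) // ler_expR.
    have -> : N%:R * (eps ^+ 2 / (8 * B ^+ 2)) =
        lam * (N%:R * eps) - N%:R * (2 * (lam * B) ^+ 2).
      by rewrite /lam; field; rewrite gt_eqF.
    by rewrite lerD2r ltW.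
  apply: ler_prod => k _; rewrite expR_ge0 /=.
  apply: le_trans (expR_le_1D (le_trans (bY p (z k)) lamB)).
  rewrite ler_expR lerD2l lerN2 ler_wpM2l //.
  by rewrite -(real_normK (num_real (Y _ _))) lerXn2r ?nnegrE // (le_trans _ (bY p (z k))).
move=> i.
have N0' : 0 < N%:R :> R by rewrite ltr0n.
have eS : N%:R^-1 * (\sum_(k < N) g i (z k)) - E (g i) =
    N%:R^-1 * \sum_(k < N) (g i (z k) - E (g i)).
  by rewrite sumrB sumr_const card_ord -(mulr_natl (E (g i))) mulrBr mulKf // gt_eqF.
rewrite eS normrM gtr0_norm ?invr_gt0 // ler_pdivrMl //.
have := key (i, true); have := key (i, false).
rewrite /Y /= -!mulr_sumr mulNr -mulrN !ler_pM2l // => h1 h2.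
by rewrite ler_norml; apply/andP; split; lra.
Qed.

End Sampling.

(** * Taylor expansion and the gradient of the heat semigroup *)

Section Gradient.
Context {R : realType} {d : nat}.
Implicit Types (f Q : 'rV[R]_d -> R) (x h G : 'rV[R]_d).

Lemma diff_grad f x h :
  'd f x h = \sum_(i < d) grad f x ord0 i * h ord0 i.
Proof.
rewrite {1}(row_sum_delta h) linear_sum; apply: eq_bigr => i _.
by rewrite linearZ mxE mulrC.
Qed.

Lemma normr_row_le h i : `|h ord0 i| <= `|h|.
Proof.
rewrite [leRHS]/(Num.norm _) /= mx_normrE.
exact: (le_bigmax _ (fun ij : 'I_1 * 'I_d => `|h ij.1 ij.2|) (ord0, i)).
Qed.

Lemma enorm_le_norm h : enorm h <= d%:R * `|h|.
Proof.
rewrite (le_trans (enorm_le_sum _)) //.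
have <- : \sum_(i < d) `|h| = d%:R * `|h| by rewrite sumr_const card_ord -[LHS]mulr_natl.
by apply: ler_sum => i _; exact: normr_row_le.
Qed.

(** A coordinatewise bound weaker than Cauchy-Schwarz; the factor [d] only enters constants whose
    size is immaterial for differentiability. *)
Lemma normr_dot_le G h :
  `|\sum_(i < d) G ord0 i * h ord0 i| <= d%:R * (enorm G * enorm h).
Proof.
rewrite (le_trans (ler_norm_sum _ _ _)) //.
have <- : \sum_(i < d) (enorm G * enorm h) = d%:R * (enorm G * enorm h).
  by rewrite sumr_const card_ord -[LHS]mulr_natl.
by apply: ler_sum => i _; rewrite normrM ler_pM // normr_le_enorm.
Qed.

Lemma is_derive_line f x h (s : R) : (forall y, differentiable f y) ->
  is_derive s 1 (fun u => f (x + u *: h)) ('d f (x + s *: h) h).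
Proof.
move=> df.
have e : (fun k : R => k^-1 *: (((fun u => f (x + u *: h)) \o shift s) (k *: 1) - f (x + s *: h)))
  = (fun k : R => k^-1 *: ((f \o shift (x + s *: h)) (k *: h) - f (x + s *: h))).
  apply/funext => k /=; congr (_ *: (f _ - _)).
  by rewrite [k *: 1]mulr1 scalerDl addrCA.
split.
  by rewrite /derivable e; exact: diff_derivable.
by rewrite /derive e -deriveE.
Qed.

(** By the mean value theorem the increment is the differential at a point [x + c *: h] with 0 < c <
    1, where the gradient has moved by at most [L * enorm h]. *)
Lemma taylor_grad f L x h : 0 <= L -> (forall y, differentiable f y) ->
    (forall y z, enorm (grad f y - grad f z) <= L * enorm (y - z)) ->
  `|f (x + h) - f x - \sum_(i < d) grad f x ord0 i * h ord0 i|
    <= d%:R * L * enorm h ^+ 2.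
Proof.
move=> L0 df lg.
have [|c c01] := @MVT R (fun u => f (x + u *: h)) (fun s => 'd f (x + s *: h) h) 0 1 ltr01
  (fun s _ => is_derive_line x h s df).
  apply: continuous_subspaceT => s.
  apply: differentiable_continuous; apply/derivable1_diffP.
  by have [] := is_derive_line x h s df.
rewrite /= scale0r addr0 scale1r subr0 mulr1 => ->.
rewrite diff_grad -sumrB.
under eq_bigr => i _ do rewrite -mulrBl -rowBE.
apply: le_trans (normr_dot_le _ _) _; rewrite -mulrA ler_wpM2l // expr2 mulrA.
rewrite ler_wpM2r ?enorm_ge0 //.
rewrite (le_trans (lg _ _)) // ler_wpM2l // [x + _]addrC addrK enormZ.
move: c01; rewrite in_itv /= => /andP[c0 c1].
by rewrite gtr0_norm // ler_piMl ?enorm_ge0 // ltW.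
Qed.

(** A quadratic remainder is o(h), so uniqueness of the differential identifies it with the linear
    form given by [G]. *)
Lemma quadratic_differentiable Q x G C :
    (forall h, `|Q (x + h) - Q x - \sum_(i < d) G ord0 i * h ord0 i| <= C * enorm h ^+ 2) ->
  differentiable Q x /\ grad Q x = G.
Proof.
move=> hQ.
pose g h := \sum_(i < d) G ord0 i * h ord0 i.
have lg : linear g.
  move=> a u v; rewrite /g scaler_sumr -big_split; apply: eq_bigr => i _ /=.
  by rewrite !mxE mulrDr mulrCA.
pose gL : {linear 'rV[R]_d -> R} := HB.pack g (GRing.isLinear.Build _ _ _ _ _ lg).
have cg : continuous gL.
  apply: (@lipschitz_continuous _ _ (d%:R * (enorm G * d%:R))) => u v.
  rewrite -linearB (le_trans (normr_dot_le G (u - v))) // -!mulrA !ler_wpM2l ?enorm_ge0 //.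
  exact: enorm_le_norm.
have ex : Q \o shift x = cst (Q x) + gL +o_ (0 : 'rV[R]_d) id.
  apply/eqaddoP => e e0.
  (* The factor [d^2] pays for passing from the Euclidean to the max norm; the 1 keeps [D]
     invertible. *)
  pose D := (`|C| * d%:R ^+ 2) + 1.
  have D0 : 0 < D by rewrite ltr_wpDl // mulr_ge0.
  have small : \forall h \near (0 : 'rV[R]_d), `|h| <= D^-1 * e.
    apply/nbhs_norm0P; exists (D^-1 * e); first by rewrite /= mulr_gt0 // invr_gt0.
    by move=> y /= /ltW.
  near=> h.
  rewrite /= !fctE [h + x]addrC opprD addrA.
  rewrite (le_trans (hQ h)) // (le_trans (ler_wpM2r (sqr_ge0 _) (ler_norm C))) //.
  rewrite (@le_trans _ _ (D * `|h| ^+ 2)) //.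
    rewrite mulrDl mul1r -mulrA -exprMn (@le_trans _ _ (`|C| * (d%:R * `|h|) ^+ 2)) //.
      by rewrite ler_wpM2l // lerXn2r ?nnegrE ?enorm_ge0 ?mulr_ge0 // enorm_le_norm.
    by rewrite lerDl sqr_ge0.
  rewrite expr2 mulrA ler_wpM2r // -ler_pdivlMl //.
  by near: h; exact: small.
have dQ := diff_unique cg ex.
split; first by apply/diff_locallyP; rewrite dQ.
apply/rowP => i; rewrite mxE dQ /= /g (bigD1 i) //= big1 ?addr0 => [|j ji].
  by rewrite mxE !eqxx mulr1.
by rewrite mxE eqxx (negbTE ji) mulr0.
Unshelve. all: by end_near. Qed.

Lemma elip_grad f L i :
  (forall y z, enorm (grad f y - grad f z) <= L * enorm (y - z)) ->
  elip L (fun x => grad f x ord0 i).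
Proof.
move=> lg y z; apply: le_trans (lg y z).
by rewrite -rowBE normr_le_enorm.
Qed.

(** The expansion of [f] at [x + sqrt t z] is averaged over z. Its remainder bound does not depend
    on the base point, so it survives averaging, and no differentiation under the integral sign is
    needed. *)
Lemma heatQ_grad f L (t : R) x : 0 <= L -> (forall y, differentiable f y) ->
    elip L f ->
    (forall y z, enorm (grad f y - grad f z) <= L * enorm (y - z)) ->
  differentiable (heatQ t f) x /\
  grad (heatQ t f) x =
    \row_i gauss_expect (fun z => grad f (x + Num.sqrt t *: z) ord0 i).
Proof.
move=> L0 df lf lg.
apply: (@quadratic_differentiable _ _ _ (d%:R * L)) => h.
set u := Num.sqrt t.
have l1 := elip_affine (x + h) u lf; have l0 := elip_affine x u lf.
have l2 i := elipZ (h ord0 i) (elip_affine x u (elip_grad i lg)).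
have lB := elipB l1 l0; have lS := elip_sum l2.
rewrite /heatQ -/u -(gauss_expectB l1 l0).
under eq_bigr => i _ do
  rewrite mxE mulrC -(gauss_expectZ _ (elip_affine x u (elip_grad i lg))).
rewrite -(gauss_expect_sum l2) -(gauss_expectB lB lS).
rewrite -[X in `|X|]subr0 -[X in _ - X](gauss_expect_cst d 0).
apply: (gauss_expect_dist (elipB lB lS) (elip_cst 0)) => z.
rewrite subr0 [x + h + _]addrAC.
under eq_bigr => i _ do rewrite mulrC.
exact: taylor_grad.
Qed.

End Gradient.

(** * Finite grids in the unit interval and in a cube *)

Section Net.
Context {R : realType}.

(** The node is the floor of s m; at s = 1 it equals m, hence m + 1 nodes. *)
Lemma unit_grid (m : nat) (s : R) : (0 < m)%N -> 0 <= s <= 1 ->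
  exists j : 'I_m.+1, `|s - j%:R / m%:R| <= m%:R^-1.
Proof.
move=> m0 /andP[s0 s1]; have m0' : 0 < m%:R :> R by rewrite ltr0n.
have sm0 : 0 <= s * m%:R by rewrite mulr_ge0.
have /andP[h1 h2] := truncn_itv sm0.
have hj : (Num.truncn (s * m%:R) < m.+1)%N.
  by rewrite ltnS -(ler_nat R) (le_trans h1) // ler_piMl.
exists (Ordinal hj) => /=; set j := Num.truncn _ in h1 h2 *.
rewrite -(ler_pM2r m0') mulVf ?gt_eqF // -[X in _ * X](gtr0_norm m0') -normrM.
rewrite mulrBl divfK ?gt_eqF //.
by move: h2; rewrite -natr1 ler_norml => h2; apply/andP; split; lra.
Qed.

Definition grid_point d (r : R) (m : nat) (a : {ffun 'I_d -> 'I_m.+1}) : 'rV[R]_d :=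
  \row_i (- r + 2 * r * ((a i)%:R / m%:R)).

Lemma box_grid d (r : R) (m : nat) (x : 'rV[R]_d) : (0 < m)%N -> 0 < r ->
    enorm x <= r ->
  exists a : {ffun 'I_d -> 'I_m.+1}, enorm (x - grid_point r a) <= d%:R * (2 * r / m%:R).
Proof.
move=> m0 r0 xr.
have hx i : exists j : 'I_m.+1, `|x ord0 i - (- r + 2 * r * (j%:R / m%:R))| <= 2 * r / m%:R.
  have := le_trans (normr_le_enorm x i) xr; rewrite ler_norml => /andP[x1 x2].
  (* Each coordinate is rescaled from [-r, r] to [0, 1]. *)
  have [|j hj] := @unit_grid m ((x ord0 i + r) / (2 * r)) m0.
    apply/andP; split; first by apply: divr_ge0; lra.
    by rewrite ler_pdivrMr; lra.
  exists j; rewrite (_ : _ - _ = 2 * r * ((x ord0 i + r) / (2 * r) - j%:R / m%:R)).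
    by rewrite normrM gtr0_norm ?mulr_gt0 // ler_wpM2l // ltW // mulr_gt0.
  by field; rewrite gt_eqF ?ltr0n //= gt_eqF.
pose a := [ffun i => sval (cid (hx i))].
exists a; rewrite (le_trans (enorm_le_sum _)) //.
have <- : \sum_(i < d) (2 * r / m%:R) = d%:R * (2 * r / m%:R).
  by rewrite sumr_const card_ord -(mulr_natl (_ / _)).
apply: ler_sum => i _; rewrite rowBE [grid_point _ _ _ _]mxE ffunE.
exact: (svalP (cid (hx i))).
Qed.

End Net.

(** * From the grid to all base points and times *)

Section Uniform.
Context {R : realType} {d : nat}.
Local Notation E := gauss_expect.

Lemma ler_norm_mean (N : nat) (a : 'I_N -> R) (c : R) : (0 < N)%N ->
  (forall i, `|a i| <= c) -> `|N%:R^-1 * \sum_i a i| <= c.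
Proof.
move=> N0 h; have N0' : 0 < N%:R :> R by rewrite ltr0n.
rewrite normrM gtr0_norm ?invr_gt0 // ler_pdivrMl // (le_trans (ler_norm_sum _ _ _)) //.
have <- : \sum_(i < N) c = N%:R * c by rewrite sumr_const card_ord -(mulr_natl c).
exact: ler_sum.
Qed.

(** The bound adds the sampling error on the grid, the discretization error twice (empirical and
    Gaussian mean), and the clipping error. The variable [u] stands for sqrt t, in which the
    dependence is Lipschitz. *)
Lemma uniform_points (J : finType) (F : J -> 'rV[R]_d -> R) (L r eps M B : R) (m N : nat) :
    0 <= L -> 0 < r -> 0 < eps -> 1 <= M -> (0 < m)%N -> (0 < N)%N ->
    (forall j, elip L (F j)) -> L * (d%:R * (2 * M)) <= B -> eps <= 2 * B ->
    2 * (#|J| * m.+1 ^ d.+1)%:R + 1 <= expR (N%:R * (eps ^+ 2 / (8 * B ^+ 2))) ->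
  exists z : nat -> 'rV[R]_d, (forall k, enorm (z k) <= M * Num.sqrt d%:R) /\
    forall j x u, enorm x <= r -> 0 <= u <= 1 ->
      `|N%:R^-1 * (\sum_(k < N) F j (x + u *: z k)) - E (fun w => F j (x + u *: w))|
      <= eps + 2 * (L * (d%:R * (2 * r / m%:R) + d%:R * M / m%:R))
         + d%:R * (L * (2 * expR (- (M ^+ 2 / 2)))).
Proof.
move=> L0 r0 eps0 M1 m0 N0 lF hB epsB hN; have M0 := le_trans ler01 M1.
pose I := (J * ({ffun 'I_d -> 'I_m.+1} * 'I_m.+1))%type.
(* Clipping inside the observable gives it bounded oscillation while keeping its Lipschitz
   constant. *)
pose g (p : I) (z : 'rV[R]_d) :=
  F p.1 (grid_point r p.2.1 + (p.2.2%:R / m%:R) *: clipv M z).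
have lu j x (u : R) : 0 <= u <= 1 -> elip L (fun z => F j (x + u *: z)).
  move=> /andP[u0 u1]; apply: elip_le (elip_affine x u (lF j)).
  by rewrite ger0_norm // ler_piMr.
have grid01 (b : 'I_m.+1) : 0 <= (b%:R / m%:R : R) <= 1.
  by rewrite divr_ge0 //= ler_pdivrMr ?ltr0n // mul1r ler_nat -ltnS.
have lg p : elip L (g p) := elip_clipv L0 M0 (lu _ _ _ (grid01 _)).
have osc p z w : `|g p z - g p w| <= B.
  apply: le_trans (lu _ _ _ (grid01 _) _ _) _; apply: le_trans hB.
  by rewrite ler_wpM2l // enorm_clipvB.
have [|z hz] := sample_points lg osc N0 eps0 epsB.
  by rewrite !card_prod card_ffun !card_ord -expnSr.
exists (fun k => clipv M (z k)); split=> [k|j x u xr u01]; first exact: enorm_clipv.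
have [a ha] := box_grid m0 r0 xr.
have [b hb] := unit_grid m0 u01.
set eta := L * _.
(* The base point is moved to the grid first, then [u]. *)
have close v : `|F j (x + u *: clipv M v) - g (j, (a, b)) v| <= eta.
  rewrite (le_trans (ler_distD (F j (grid_point r a + u *: clipv M v)) _ _)) //.
  rewrite /eta mulrDr lerD //.
    rewrite (le_trans (lF j _ _)) // opprD addrACA subrr addr0.
    by rewrite ler_wpM2l.
  rewrite (le_trans (lF j _ _)) // opprD addrACA subrr add0r -scalerBl enormZ.
  rewrite ler_wpM2l // mulrC.
  by apply: ler_pM => //; [exact: enorm_ge0|exact: enorm_clipv_le].
have h1 : `|N%:R^-1 * (\sum_(k < N) F j (x + u *: clipv M (z k)))
    - N%:R^-1 * (\sum_(k < N) g (j, (a, b)) (z k))| <= eta.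
  by rewrite -mulrBr -sumrB; apply: ler_norm_mean => // k; exact: close.
have lc := elip_clipv L0 M0 (lu j x u u01).
have h2 : `|E (g (j, (a, b))) - E (fun w => F j (x + u *: clipv M w))| <= eta.
  by apply: (gauss_expect_dist (lg _) lc) => w; rewrite distrC close.
have h3 := gauss_expect_clipv L0 M1 (lu j x u u01).
have h4 := hz (j, (a, b)).
move: h1 h2 h3 h4.
set A1 := N%:R^-1 * _; set A2 := N%:R^-1 * _; set A3 := E _; set A4 := E _; set A5 := E _.
set c := d%:R * (L * _).
rewrite !ler_norml => /andP[? ?] /andP[? ?] /andP[? ?] /andP[? ?].
by apply/andP; split; lra.
Qed.

End Uniform.

(** * Numerical bounds for the chosen parameters *)

Section Constants.
Context {R : realType}.
Implicit Types (X L r : R) (D d : nat).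

(** The grid has [D ^ 9] steps, N = [D ^ 20], accuracy X^-3 and oscillation X^5, so the exponent is
    X^4 / 8. The left side is at most X^(10 D + 2), whose logarithm is at most (10 X + 2) X. *)
Lemma net_size_le D d : 2000 <= D%:R :> R -> (d.+1 <= D)%N ->
  2 * (d.+1 * (D ^ 9).+1 ^ d.+1)%:R + 1 <=
  expR ((D ^ 20)%:R * ((D%:R ^- 3) ^+ 2 / (8 * (D%:R ^+ 5) ^+ 2))) :> R.
Proof.
move=> hX dD; set X : R := D%:R in hX *.
have X0 : 0 < X by lra.
have D2 : (1 < D)%N by rewrite -(ltr_nat R) -/X; lra.
have hn : (d.+1 * (D ^ 9).+1 ^ d.+1 <= D * (D ^ 10) ^ D)%N.
  rewrite leq_mul //; apply: (@leq_trans ((D ^ 10) ^ d.+1)).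
    by rewrite leq_exp2r // ltn_exp2l.
  by rewrite leq_pexp2l // expn_gt0 (ltn_trans _ D2).
have hn' : (d.+1 * (D ^ 9).+1 ^ d.+1)%:R <= X * X ^+ (10 * D).
  by rewrite exprM -!natrX -natrM ler_nat.
have Y1 : 1 <= X ^+ (10 * D) by apply: exprn_ege1; lra.
apply: (@le_trans _ _ (X ^+ (10 * D).+2)).
  rewrite !exprS; move: hn' Y1; set Y := X ^+ _; set n := _%:R => hn' Y1.
  have : X * Y * 3 <= X * Y * X by apply: ler_wpM2l; [apply: mulr_ge0|]; lra.
  have : 1 <= X * Y by rewrite -[1]mulr1 ler_pM //; lra.
  by rewrite (mulrC X (X * Y)); lra.
rewrite -[X in X ^+ _]lnK ?posrE // -expRM_natl ler_expR.
apply: (@le_trans _ _ ((10 * D).+2%:R * X)).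
  by rewrite ler_wpM2l // ltW // ln_sublinear.
rewrite natrX -/X -addn2 natrD natrM -/X.
have -> : X ^+ 20 * (X ^- 3 ^+ 2 / (8 * X ^+ 5 ^+ 2)) = X ^+ 2 * X ^+ 2 / 8.
  by field; rewrite gt_eqF.
have : 2000 * X <= X ^+ 2 by rewrite expr2 ler_wpM2r // ltW.
have X2 : 2000 <= X ^+ 2 by rewrite expr2; nra.
have : 2000 * X ^+ 2 <= X ^+ 2 * X ^+ 2 by apply: ler_wpM2r => //; apply: sqr_ge0.
by rewrite mulrDl -mulrA -expr2; lra.
Qed.

(** With N = X^20, M^2 / 2 = 32 log N, so the tail is N^-32, far below the stated N^-1; also M <=
    M^2 = 1280 log X <= X^2. *)
Lemma truncation_radius X M : 2000 <= X -> M = 8 * Num.sqrt (ln (X ^+ 20)) ->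
  [/\ 1 <= M, M <= X ^+ 2 & expR (- (M ^+ 2 / 2)) <= X ^- 20].
Proof.
move=> hX eM; have X0 : 0 < X by lra.
have lX : 2^-1 <= ln X.
  rewrite -ler_expR lnK ?posrE //.
  have h := expR_ge1Dx (- 2^-1 : R); have p := expR_gt0 (2^-1 : R).
  have : expR (2^-1 : R) * expR (- 2^-1) = 1 by rewrite -expRD subrr expR0.
  by nra.
have lX' : ln X <= X by rewrite ltW // ln_sublinear.
have l0 : 0 <= ln (X ^+ 20) by rewrite lnXn // mulrn_wge0 //; lra.
have M2 : M ^+ 2 = 64 * ln (X ^+ 20) by rewrite eM exprMn sqr_sqrtr //; ring.
have l20 : ln (X ^+ 20) = 20 * ln X by rewrite lnXn // -[LHS]mulr_natl.
have M0 : 0 <= M by rewrite eM mulr_ge0 // sqrtr_ge0.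
have M1 : 1 <= M by rewrite -(@expr_ge1 _ 2 M) // M2 l20; lra.
split=> //.
  apply: (@le_trans _ _ (M ^+ 2)); first by rewrite expr2 ler_peMr.
  rewrite M2 l20 expr2; apply: (@le_trans _ _ (1280 * X)); first by lra.
  by rewrite ler_wpM2r; lra.
have -> : X ^- 20 = expR (- ln (X ^+ 20)) by rewrite expRN lnK // posrE exprn_gt0.
by rewrite ler_expR M2; lra.
Qed.

(** Each discretization error and the clipping error is at most X^-4, and X^-3 + 3 X^-4 <= X^-2. *)
Lemma total_error_le X L r d M : 2000 <= X -> 0 <= L <= X -> 0 < r <= X -> d%:R <= X ->
    M = 8 * Num.sqrt (ln (X ^+ 20)) ->
  X ^- 3 + 2 * (L * (d%:R * (2 * r / X ^+ 9) + d%:R * M / X ^+ 9))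
    + d%:R * (L * (2 * expR (- (M ^+ 2 / 2)))) <= X ^- 2.
Proof.
move=> hX /andP[L0 LX] /andP[r0 rX] dX /(truncation_radius hX)[M1 MX eM].
have X0 : 0 < X by lra.
have d0 : 0 <= d%:R :> R by [].
have X2 : X <= X ^+ 2 by rewrite expr2; nra.
have h1 : L * (d%:R * (2 * r / X ^+ 9) + d%:R * M / X ^+ 9) <= X ^- 4.
  have -> : L * (d%:R * (2 * r / X ^+ 9) + d%:R * M / X ^+ 9) =
      L * (d%:R * (2 * r + M)) / X ^+ 9 by ring.
  have -> : X ^- 4 = X ^+ 5 / X ^+ 9 by field; rewrite gt_eqF.
  rewrite ler_pM2r ?invr_gt0 ?exprn_gt0 //.
  have -> : X ^+ 5 = X * (X * X ^+ 3) by ring.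
  apply: ler_pM => //; first by rewrite mulr_ge0 //; lra.
  apply: ler_pM => //; first by lra.
  rewrite exprS; have : 3 * X ^+ 2 <= X * X ^+ 2 by rewrite ler_wpM2r ?sqr_ge0; lra.
  by lra.
have h2 : d%:R * (L * (2 * expR (- (M ^+ 2 / 2)))) <= X ^- 4.
  have -> : X ^- 4 = X * (X * (X ^+ 14 * X ^- 20)) by field; rewrite gt_eqF.
  have e0 := expR_ge0 (- (M ^+ 2 / 2)).
  apply: ler_pM => //; first by rewrite mulr_ge0 ?mulr_ge0.
  apply: ler_pM => //.
  apply: ler_pM => //.
  apply: (@le_trans _ _ X); first by lra.
  by rewrite -[leLHS]expr1 ler_weXn2l //; lra.
have X4 : 0 < X ^- 4 by rewrite invr_gt0 exprn_gt0.
have -> : X ^- 2 = X ^+ 2 * X ^- 4 by field; rewrite gt_eqF.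
have -> : X ^- 3 = X * X ^- 4 by field; rewrite gt_eqF.
by nra.
Qed.

Lemma oscillation_le X L d M : 2000 <= X -> 0 <= L <= X -> d%:R <= X ->
  0 <= M <= X ^+ 2 -> L * (d%:R * (2 * M)) <= X ^+ 5.
Proof.
move=> hX /andP[L0 LX] dX /andP[M0 MX].
have -> : X ^+ 5 = X * (X * X ^+ 3) by ring.
have d0 : 0 <= d%:R :> R by [].
apply: ler_pM => //; first by rewrite mulr_ge0 //; lra.
apply: ler_pM => //; first by lra.
rewrite exprS; apply: (@le_trans _ _ (2 * X ^+ 2)); first by lra.
by rewrite ler_wpM2r ?sqr_ge0 //; lra.
Qed.

(** The factor [d] serves the gradient estimate, where [d] coordinate errors are added. *)
Lemma accuracy_le X (eps : R) d : 0 < eps -> eps^-1 <= X -> d%:R + 1 <= X ->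
  d%:R * X ^- 2 <= eps /\ X ^- 2 <= eps.
Proof.
move=> eps0 VX dX; have V0 : 0 < eps^-1 by rewrite invr_gt0.
have X0 : 0 < X by apply: lt_le_trans VX.
have d0 : 0 <= d%:R :> R by [].
have Ve : X^-1 <= eps by rewrite -[eps]invrK lef_pV2 ?posrE.
have -> : X ^- 2 = X^-1 * X^-1 by field; rewrite gt_eqF.
have V1 : 0 < X^-1 by rewrite invr_gt0.
have VX1 : X * X^-1 = 1 by rewrite divff // gt_eqF.
have h1 : d%:R * X^-1 <= X * X^-1 by rewrite ler_wpM2r //; lra.
have h2 : 1 * X^-1 <= X * X^-1 by rewrite ler_wpM2r //; lra.
rewrite VX1 mul1r in h1 h2; split; apply: le_trans Ve.
  by rewrite mulrA ler_piMl // ltW.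
by rewrite ler_piMl // ltW.
Qed.

Lemma natr_expn_le (C D k : nat) (S : R) : D%:R <= C%:R * S ->
  (D ^ k)%:R <= (C ^ k)%:R * S ^+ k.
Proof.
by move=> h; rewrite !natrX -exprMn; apply: lerXn2r => //; rewrite nnegrE // (le_trans _ h).
Qed.

End Constants.

(** * Uniform approximation of the heat semigroup and its gradient by polynomially many points *)

Theorem theorem5 :
  exists (C k : nat),
  forall (R : realType) (d : nat) (L : R) (f : 'rV[R]_d -> R),
    0 <= L ->
    (forall x, differentiable f x) ->
    (forall x y, `|f x - f y| <= L * enorm (x - y)) ->
    (forall x y, enorm (grad f x - grad f y) <= L * enorm (x - y)) ->
  forall (eps r : R), 0 < eps -> 0 < r ->
  exists (N : nat) (z : 'I_N -> 'rV[R]_d),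
    [/\ (0 < N)%N,
        N%:R <= C%:R * (1 + eps^-1 + d%:R + L + r) ^+ k,
        (forall n, enorm (z n) <= 8 * Num.sqrt ((d%:R + 6) * ln (N%:R : R))),
        (forall (x : 'rV[R]_d) (t : R), enorm x <= r -> 0 <= t <= 1 ->
           `| N%:R^-1 * \sum_(n < N) f (x + Num.sqrt t *: z n) - heatQ t f x |
             <= eps) &
        (forall (x : 'rV[R]_d) (t : R), enorm x <= r -> 0 <= t <= 1 ->
           differentiable (heatQ t f) x /\
           enorm (N%:R^-1 *: \sum_(n < N) grad f (x + Num.sqrt t *: z n)
                  - grad (heatQ t f) x) <= eps)].
Proof.
(* N is [D ^ 20] with D <= S + 2000 <= 2001 S, because S >= 1. *)
exists (2001 ^ 20)%N, 20 => R d L f L0 df lf lg eps r eps0 r0.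
pose S := 1 + eps^-1 + d%:R + L + r.
have V0 : 0 < eps^-1 by rewrite invr_gt0.
have d0 : 0 <= d%:R :> R by [].
have S0 : 0 <= S by rewrite /S; lra.
pose D := (Num.truncn S + 2000)%N; set X : R := D%:R.
have [SX XS hX] : [/\ S <= X, X <= 2001 * S & 2000 <= X].
  have /andP[] := truncn_itv S0.
  have XE : X = (Num.truncn S)%:R + 2000 by rewrite /X /D natrD.
  rewrite XE -natr1; set q := (Num.truncn S)%:R => h1 h2.
  have q0 : 0 <= q by [].
  have S1 : 1 <= S by rewrite /S; lra.
  by split; lra.
have D0 : (0 < D)%N by rewrite addn_gt0 orbT.
have dX : (d.+1 <= D)%N by rewrite -(ler_nat R) -natr1 -/X; move: SX; rewrite /S; lra.
have [LX rX VX] : [/\ L <= X, r <= X & eps^-1 <= X] by move: SX; rewrite /S; split; lra.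
have X0 : 0 < X by lra.
pose M := 8 * Num.sqrt (ln (X ^+ 20)).
have [M1 MX _] := truncation_radius hX (erefl M).
(* [None] stands for [f] and [Some i] for its i-th partial derivative, so one family of d + 1
   functions yields common points for both estimates. *)
pose F (j : option 'I_d) : 'rV[R]_d -> R :=
  if j is Some i then fun x => grad f x ord0 i else f.
have lF j : elip L (F j) by case: j => [i|] //; exact: elip_grad.
have d1X : d%:R + 1 <= X by rewrite natr1 ler_nat.
have d2X : d%:R < X by rewrite ltr_nat.
have hB : L * (d%:R * (2 * M)) <= X ^+ 5.
  apply: oscillation_le => //; [exact/andP|exact: ltW|].
  by rewrite MX (le_trans ler01 M1).
have e30 : 0 < X ^- 3 by rewrite invr_gt0 exprn_gt0.
have eB : X ^- 3 <= 2 * X ^+ 5.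
  have X1 : 1 <= X by rewrite ler1n.
  rewrite (@le_trans _ _ 1) ?invf_le1 ?exprn_gt0 ?exprn_ege1 //.
  by rewrite -[leLHS]mulr1 ler_pM ?exprn_ege1 // ler1n.
have D9 : (0 < D ^ 9)%N by rewrite expn_gt0 D0.
have D20 : (0 < D ^ 20)%N by rewrite expn_gt0 D0.
have [|z [zM hz]] := uniform_points L0 r0 e30 M1 D9 D20 lF hB eB.
  by rewrite card_option card_ord net_size_le.
have err := @total_error_le R X L r d M hX.
have {}hz j x (t : R) : enorm x <= r -> 0 <= t <= 1 ->
    `|(D ^ 20)%:R^-1 * (\sum_(k < D ^ 20) F j (x + Num.sqrt t *: z k))
      - gauss_expect (fun w => F j (x + Num.sqrt t *: w))| <= X ^- 2.
  move=> xr /andP[t0 t1]; apply: le_trans (hz j x _ xr _) _.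
    by rewrite sqrtr_ge0 -sqrtr1 ler_wsqrtr.
  rewrite natrX; apply: err => //; [exact/andP|exact/andP|exact: ltW].
have X2 := accuracy_le eps0 VX d1X.
exists (D ^ 20)%N, (fun n => z n); split=> //.
- exact: natr_expn_le.
(* The clipped points have norm at most 8 sqrt(log N) sqrt d, and d <= d + 6. *)
- move=> n; rewrite (le_trans (zM n)) // /M -mulrA ler_wpM2l // natrX -/X.
  rewrite -sqrtrM; last by rewrite ln_ge0 // exprn_ege1 //; lra.
  rewrite ler_wsqrtr // mulrC ler_wpM2r //; last lra.
  by rewrite ln_ge0 // exprn_ege1 //; lra.
- by move=> x t xr t01; apply: le_trans (hz None x t xr t01) X2.2.
move=> x t xr t01; have [dQ ->] := heatQ_grad t x L0 df lf lg.
split=> //; rewrite (le_trans (enorm_le_sum _)) //; apply: le_trans X2.1.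
have <- : \sum_(i < d) X ^- 2 = d%:R * X ^- 2.
  by rewrite sumr_const card_ord -(mulr_natl (X ^- 2)).
apply: ler_sum => i _; rewrite rowBE.
rewrite rowZE summxE; set E := \row__ _; rewrite [E _ _]mxE.
exact: (hz (Some i) x t xr t01).
Qed.
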